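(* Every locally nilpotent element in $\mathfrak g$ is nilpotent.
   Context: Let $\dot{\mathfrak g}$ be a finite-dimensional complex simple Lie algebra and $\mathcal K=\mathbb C[[t]][t^{-1}]$ the field of formal Laurent series. The affine Kac-Moody algebra is $\mathfrak g=(\mathbb C[t,t^{-1}]\otimes\dot{\mathfrak g})\oplus\mathbb Cc\oplus\mathbb Cd$ and its completion is $\hat{\mathfrak g}=(\mathcal K\otimes\dot{\mathfrak g})\oplus\mathbb Cc\oplus\mathbb Cd\supset\mathfrak g$, both with bracket $$[x+\lambda c+\mu d,\ y+\lambda' c+\mu' d]=[x,y]+\mu t\tfrac{dy}{dt}-\mu' t\tfrac{dx}{dt}+\mathrm{res}\langle \tfrac{dx}{dt},y\rangle_t\,c,$$ where $\langle\,,\rangle_t$ is the $\mathcal K$-bilinear extension of the Killing form of $\dot{\mathfrak g}$ and $\mathrm{res}$ is the coefficient of $t^{-1}$. An element $X$ is locally nilpotent if $\mathrm{ad}X$ is a locally nilpotent endomorphism of $\hat{\mathfrak g}$ (for each $Y\in\hat{\mathfrak g}$ there is $k$ with $(\mathrm{ad}X)^kY=0$), and nilpotent if $\mathrm{ad}X$ is a nilpotent endomorphism of $\hat{\mathfrak g}$ (there is $k$ with $(\mathrm{ad}X)^k=0$). *)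

(* Defs.v *)
From HB Require Import structures.
From mathcomp Require Import all_boot all_order all_algebra.
From mathcomp Require Import sesquilinear.
From mathcomp Require Import complex.
From mathcomp Require Import boolp classical_sets functions cardinality fsbigop.
From mathcomp Require Import reals.
From mathcomp Require Import zify.

Set Implicit Arguments.
Unset Strict Implicit.
Unset Printing Implicit Defensive.

Import Order.TTheory GRing.Theory Num.Theory.

Local Open Scope classical_set_scope.
Local Open Scope ring_scope.

HB.mixin Record Vector_isLieAlgebra (F : fieldType) (L : Type)
    of Vector F L := {
  lie : L -> L -> L;
  lie_is_bilinear : bilinear_for *:%R *:%R lie;
  liexx : forall x, lie x x = 0;
  lie_jacobi : forall x y z,
    lie x (lie y z) + lie y (lie z x) + lie z (lie x y) = 0
}.

#[short(type="lieAlgType")]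
HB.structure Definition LieAlgebra (F : fieldType) :=
  {L of Vector_isLieAlgebra F L & Vector F L}.

HB.instance Definition _ (F : fieldType) (L : lieAlgType F) :=
  bilinear_isBilinear.Build F L L L *:%R *:%R (@lie F L) (@lie_is_bilinear F L).

HB.instance Definition _ (F : fieldType) (L : lieAlgType F) (x : L) :=
  GRing.isSemilinear.Build F L L *:%R (lie x)
    (GRing.semilinear_linear ((@lie_is_bilinear F L).2 x)).

Section FiniteDimensional.
Variables (F : fieldType) (L : lieAlgType F).
Implicit Types x y : L.

Definition lie_ideal (I : {vspace L}) : Prop :=
  forall x y, y \in I -> lie x y \in I.

Definition lie_simple : Prop :=
  (exists x, exists y, lie x y != 0) /\
  (forall I : {vspace L}, lie_ideal I -> I = 0%VS \/ I = fullv).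

Definition lie_ad x : 'End(L) := linfun (lie x).

Definition lfun_trace (h : 'End(L)) : F :=
  \tr (passmx.mxof (vbasis {:L}) (vbasis {:L}) h).

Definition killing x y : F^o := lfun_trace (lie_ad x \o lie_ad y)%VF.

Lemma lie_adE x y : lie_ad x y = lie x y.
Proof. by rewrite /lie_ad lfunE. Qed.

Lemma lie_ad_is_linear : linear lie_ad.
Proof.
move=> a x x'; apply/lfunP => y.
by rewrite add_lfunE scale_lfunE !lie_adE linearPl.
Qed.

Lemma lfun_trace_is_scalar : scalar lfun_trace.
Proof.
by move=> a g h; rewrite /lfun_trace passmx.mxof_linear mxtraceD mxtraceZ.
Qed.

Lemma killing_is_bilinear : bilinear_for *:%R *:%R killing.
Proof.
split=> z a x x'; rewrite /killing lie_ad_is_linear.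
  by rewrite comp_lfunDl -comp_lfunZl lfun_trace_is_scalar.
by rewrite comp_lfunDr -comp_lfunZr lfun_trace_is_scalar.
Qed.

HB.instance Definition _ :=
  bilinear_isBilinear.Build F L L F^o *:%R *:%R killing killing_is_bilinear.

End FiniteDimensional.

(* [laurent V] is the space of formal Laurent series [\sum_n t^n v_n] with
   coefficients in [V]; a series is given by its coefficient function, whose
   support is bounded below.  Thus the field of scalar Laurent series is
   [laurent F^o]; for finite-dimensional [V], [laurent V] is its tensor product
   with [V] over [F] (lemma [laurent_tensor_universal]). *)
Section LaurentDef.
Variables (F : fieldType) (V : lmodType F).

Definition bounded_below : {pred (int -> V)} :=
  fun f => `[< exists m : int, forall n : int, n < m -> f n = 0 >].

Fact bounded_below_submod : GRing.submod_closed bounded_below.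
Proof.
split; first by apply/asboolP; exists 0.
move=> a f g /asboolP[m fm] /asboolP[m' gm']; apply/asboolP.
exists (Num.min m m') => n; rewrite lt_min => /andP[nm nm'].
by rewrite !fctE fm // gm' // scaler0 addr0.
Qed.

HB.instance Definition _ :=
  GRing.isSubmodClosed.Build F (int -> V) bounded_below
    (GRing.submod_closed_semi bounded_below_submod).

Record laurent := Laurent {
  laurent_coef :> int -> V;
  laurent_bounded : laurent_coef \in bounded_below
}.

HB.instance Definition _ := [isSub of laurent for laurent_coef].
HB.instance Definition _ := [Choice of laurent by <:].
HB.instance Definition _ := [SubChoice_isSubLmodule of laurent by <:].

End LaurentDef.

Section LaurentTheory.
Variable F : fieldType.
Implicit Types U V W : lmodType F.

Lemma laurentP V (u v : laurent V) : (forall n, u n = v n) -> u = v.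
Proof. by move=> uv; apply/val_inj/funext. Qed.

Lemma laurent_boundP V (u : laurent V) :
  exists m : int, forall n : int, n < m -> u n = 0.
Proof. exact/asboolP/laurent_bounded. Qed.

Lemma laurent_coefD V (u v : laurent V) n : (u + v) n = u n + v n.
Proof. by []. Qed.

Lemma laurent_coefZ V (a : F) (u : laurent V) n : (a *: u) n = a *: u n.
Proof. by []. Qed.

Fact laurent_deriv_subproof V (u : laurent V) :
  (fun n : int => u (n + 1) *~ (n + 1)) \in @bounded_below F V.
Proof.
have [m um] := laurent_boundP u; apply/asboolP; exists (m - 1) => n nm.
by rewrite um ?mul0rz // -ltrBrDr.
Qed.
Definition laurent_deriv V (u : laurent V) : laurent V :=
  Laurent (laurent_deriv_subproof u).

(* multiplication by [t] *)
Fact laurent_tmul_subproof V (u : laurent V) :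
  (fun n : int => u (n - 1)) \in @bounded_below F V.
Proof.
have [m um] := laurent_boundP u; apply/asboolP; exists (m + 1) => n nm.
by rewrite um // ltrBlDr.
Qed.
Definition laurent_tmul V (u : laurent V) : laurent V :=
  Laurent (laurent_tmul_subproof u).

Definition laurent_res (f : laurent F^o) : F^o := f (-1).

(* The extension of an [F]-bilinear map to Laurent series that is bilinear over
   scalar Laurent series (see [laurent_ext_tensor]).  The sum ranges over all
   integers, but has finitely many nonzero terms. *)
Fact laurent_ext_subproof U V W (b : {bilinear U -> V -> W})
    (u : laurent U) (v : laurent V) :
  (fun n : int => \sum_(i \in [set: int]) b (u i) (v (n - i)))
    \in @bounded_below F W.
Proof.
have [p up] := laurent_boundP u; have [q vq] := laurent_boundP v.
apply/asboolP; exists (p + q) => n npq; apply: fsbig1 => i _.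
have [/up ->|pi] := ltP i p; first by rewrite linear0l.
by rewrite [v _]vq ?linear0r //; lia.
Qed.
Definition laurent_ext U V W (b : {bilinear U -> V -> W})
    (u : laurent U) (v : laurent V) : laurent W :=
  Laurent (laurent_ext_subproof b u v).

Definition scale_op V (a : F^o) (v : V) : V := (a : F) *: v.

Lemma scale_op_is_bilinear V : bilinear_for *:%R *:%R (@scale_op V).
Proof.
split=> [v a b c|a b v w]; rewrite /scale_op.
  by rewrite scalerDl -scalerA.
by rewrite scalerDr scalerA (mulrC (a : F) (b : F)) -scalerA.
Qed.

HB.instance Definition _ V :=
  bilinear_isBilinear.Build F F^o V V *:%R *:%R (@scale_op V)
    (@scale_op_is_bilinear V).

Definition laurent_mul (f g : laurent F^o) : laurent F^o :=
  laurent_ext (@scale_op F^o) f g.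

Fact laurent_tensor_subproof V (f : laurent F^o) (x : V) :
  (fun n : int => (f n : F) *: x) \in @bounded_below F V.
Proof.
have [m fm] := laurent_boundP f; apply/asboolP; exists m => n nm.
by rewrite fm // scale0r.
Qed.
Definition laurent_tensor V (f : laurent F^o) (x : V) : laurent V :=
  Laurent (laurent_tensor_subproof f x).

Lemma laurent_extE U V W (b : {bilinear U -> V -> W})
    (u : laurent U) (v : laurent V) (p q n : int) (N : nat) :
  (forall i, i < p -> u i = 0) -> (forall i, i < q -> v i = 0) ->
  n - p - q < N%:Z ->
  laurent_ext b u v n = \sum_(k < N) b (u (p + k%:Z)) (v (n - (p + k%:Z))).
Proof.
move=> up vq nN; pose s : seq int := [seq p + k%:Z | k <- iota 0 N].
rewrite /= -set_true -(@bigfs _ _ _ _ s).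
- by rewrite big_map -{1}(subn0 N) big_mkord.
- by rewrite map_inj_uniq ?iota_uniq // => k l /addrI[].
move=> i _ /mapP si; have [/up ->|pi] := ltP i p; first by rewrite linear0l.
rewrite [v _]vq ?linear0r // ltNge; apply/negP => qi; apply: si.
exists `|i - p|%N; [rewrite mem_iota|]; lia.
Qed.

Lemma laurent_ext_is_bilinear U V W (b : {bilinear U -> V -> W}) :
  bilinear_for *:%R *:%R (laurent_ext b).
Proof.
split=> [v a u u'|u a v v']; apply: laurentP => n;
  rewrite laurent_coefD laurent_coefZ.
  have [p up] := laurent_boundP u; have [p' up'] := laurent_boundP u'.
  have [q vq] := laurent_boundP v; pose m := Num.min p p'.
  rewrite !(@laurent_extE _ _ _ b _ _ m q n (absz (n - m - q)%R).+1) //.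
  - rewrite scaler_sumr -big_split /=; apply: eq_bigr => k _.
    exact: (linearPl b (v _) a (u _) (u' _)).
  - by move=> i im; rewrite up' //; lia.
  - lia.
  - by move=> i im; rewrite up //; lia.
  - lia.
  - move=> i im; rewrite -[LHS]/(a *: u i + u' i).
    by rewrite up ?up' ?scaler0 ?addr0 //; lia.
  - lia.
have [p up] := laurent_boundP u; have [q vq] := laurent_boundP v.
have [q' vq'] := laurent_boundP v'; pose m := Num.min q q'.
rewrite !(@laurent_extE _ _ _ b _ _ p m n (absz (n - p - m)%R).+1) //.
- rewrite scaler_sumr -big_split /=; apply: eq_bigr => k _.
  exact: (linearPr b (u _) a (v _) (v' _)).
- by move=> i im; rewrite vq' //; lia.
- lia.
- by move=> i im; rewrite vq //; lia.
- lia.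
- move=> i im; rewrite -[LHS]/(a *: v i + v' i).
  by rewrite vq ?vq' ?scaler0 ?addr0 //; lia.
- lia.
Qed.

HB.instance Definition _ U V W (b : {bilinear U -> V -> W}) :=
  bilinear_isBilinear.Build F (laurent U) (laurent V) (laurent W)
    *:%R *:%R (laurent_ext b) (laurent_ext_is_bilinear b).

Lemma laurent_ext_tensor U V W (b : {bilinear U -> V -> W}) f g x y :
  laurent_ext b (laurent_tensor f x) (laurent_tensor g y)
    = laurent_tensor (laurent_mul f g) (b x y).
Proof.
have [p fp] := laurent_boundP f; have [q gq] := laurent_boundP g.
apply: laurentP => n.
rewrite (@laurent_extE _ _ _ b _ _ p q n (absz (n - p - q)%R).+1).
- rewrite [RHS]/=.
  rewrite [X in X *: _](@laurent_extE _ _ _ _ f g p q n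
    (absz (n - p - q)%R).+1) //.
    rewrite scaler_suml; apply: eq_bigr => k _ /=.
    by rewrite linearZl linearZr /= scalerA.
  lia.
- by move=> i ip /=; rewrite fp // scale0r.
- by move=> i iq /=; rewrite gq // scale0r.
- lia.
Qed.

Lemma laurent_tensor_is_bilinear V : bilinear_for *:%R *:%R (@laurent_tensor V).
Proof.
split=> [x a f g|f a x y]; apply: laurentP => n;
  rewrite laurent_coefD laurent_coefZ /=.
  by rewrite scalerDl scalerA.
by rewrite scalerDr !scalerA mulrC.
Qed.

HB.instance Definition _ V :=
  bilinear_isBilinear.Build F (laurent F^o) V (laurent V) *:%R *:%R
    (@laurent_tensor V) (@laurent_tensor_is_bilinear V).

End LaurentTheory.

Section LaurentTensor.
Variables (F : fieldType) (V : vectType F).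

Fact laurent_coord_subproof (i : 'I_(\dim {:V})) (u : laurent V) :
  (fun n : int => coord (vbasis {:V}) i (u n) : F^o) \in @bounded_below F F^o.
Proof.
have [m um] := laurent_boundP u; apply/asboolP; exists m => n nm.
by rewrite um // linear0.
Qed.
Definition laurent_coord i (u : laurent V) : laurent F^o :=
  Laurent (laurent_coord_subproof i u).

Lemma laurent_coord_is_linear i : linear (laurent_coord i).
Proof. by move=> a u v; apply: laurentP => n /=; rewrite linearP. Qed.

HB.instance Definition _ i :=
  GRing.isSemilinear.Build F (laurent V) (laurent F^o) *:%R (laurent_coord i)
    (GRing.semilinear_linear (laurent_coord_is_linear i)).

Lemma laurent_coef_sum I (r : seq I) (w : I -> laurent V) n :
  (\sum_(i <- r) w i) n = \sum_(i <- r) w i n.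
Proof.
by elim: r => [|i r IH]; rewrite ?big_nil // !big_cons laurent_coefD IH.
Qed.

Lemma laurent_coord_tensor (u : laurent V) :
  u = \sum_i laurent_tensor (laurent_coord i u) (vbasis {:V})`_i.
Proof.
apply: laurentP => n.
by rewrite laurent_coef_sum {1}[u n](coord_vbasis (memvf _)).
Qed.

Lemma laurent_tensor_universal (W : lmodType F)
    (phi : {bilinear laurent F^o -> V -> W}) :
  exists2 Phi : {linear laurent V -> W},
    forall f x, Phi (laurent_tensor f x) = phi f x &
    forall Psi : {linear laurent V -> W},
      (forall f x, Psi (laurent_tensor f x) = phi f x) -> Psi =1 Phi.
Proof.
pose Phi (u : laurent V) := \sum_i phi (laurent_coord i u) (vbasis {:V})`_i.
have Phi_lin : linear Phi.
  move=> a u v; rewrite /Phi scaler_sumr -big_split /=.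
  by apply: eq_bigr => i _; rewrite linearP linearPl.
pose PhiL : {linear laurent V -> W} := HB.pack Phi
  (GRing.isSemilinear.Build F (laurent V) W *:%R Phi
    (GRing.semilinear_linear Phi_lin)).
exists PhiL => [f x|Psi Psi_tensor u].
  rewrite /= /Phi {2}[x](coord_vbasis (memvf _)) linear_sumr /=.
  apply: eq_bigr => i _; rewrite linearZr -linearZl_LR /=.
  congr (phi _ _); apply: laurentP => n.
  by rewrite laurent_coefZ /= linearZ /= mulrC.
by rewrite {1}[u]laurent_coord_tensor linear_sum; apply: eq_bigr.
Qed.

End LaurentTensor.

(* [(x, l, m) : affine_hat L] stands for [x + l c + m d]. *)
Section Affine.
Variables (F : fieldType) (L : lieAlgType F).

Definition affine_hat : Type := (laurent L * F^o * F^o)%type.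

HB.instance Definition _ :=
  GRing.Lmodule.copy affine_hat (laurent L * F^o * F^o)%type.

Definition affine_lie (X Y : affine_hat) : affine_hat :=
  let: (x, _, m) := X in
  let: (y, _, m') := Y in
  (laurent_ext (@lie F L) x y
   + (m : F) *: laurent_tmul (laurent_deriv y)
   - (m' : F) *: laurent_tmul (laurent_deriv x),
   laurent_res (laurent_ext (@killing F L) (laurent_deriv x) y),
   0).

Lemma affine_lie_is_linear X : linear (affine_lie X).
Proof.
case: X => [[x l] m] a [[y r] m'] [[z s] m''].
have comb (A B C D E : laurent L) (p q q' : F) :
    a *: A + B + p *: (a *: C + D) - (a * q + q') *: E
      = a *: (A + p *: C - q *: E) + (B + p *: D - q' *: E).
  rewrite scalerDl -scalerA !scalerDr scalerN (scalerA p a) (mulrC p a).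
  by rewrite -scalerA opprD (addrACA (a *: A)) [LHS]addrACA.
pose T u : laurent L := laurent_tmul (laurent_deriv u).
have TP : T (a *: y + z) = a *: T y + T z.
  apply: laurentP => n; rewrite -[LHS]/((a *: y (n - 1 + 1) + z (n - 1 + 1))
    *~ (n - 1 + 1)) mulrzDl scalerMzr.
  by [].
have bP : laurent_ext (@lie F L) x (a *: y + z)
    = a *: laurent_ext (@lie F L) x y + laurent_ext (@lie F L) x z.
  exact: (laurent_ext_is_bilinear _).2.
have kP : laurent_ext (@killing F L) (laurent_deriv x) (a *: y + z)
    = a *: laurent_ext (@killing F L) (laurent_deriv x) y
      + laurent_ext (@killing F L) (laurent_deriv x) z.
  exact: (laurent_ext_is_bilinear _).2.
have pairP (P Q : affine_hat) :
  P.1.1 = Q.1.1 -> P.1.2 = Q.1.2 -> P.2 = Q.2 -> P = Q.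
  by case: P Q => [[? ?] ?] [[? ?] ?] /= -> -> ->.
apply: pairP => /=.
- transitivity (laurent_ext (@lie F L) x (a *: y + z)
      + (m : F) *: T (a *: y + z)
      - (a * m' + m'' : F) *: T x); first by [].
  by rewrite TP bP; exact: comb.
- exact: (congr1 (@laurent_res F) kP).
- by rewrite scaler0 addr0.
Qed.

(* the elements whose loop component lies in [F[t, t^-1] (x) L] *)
Definition affine : set affine_hat :=
  [set X : affine_hat | let: (x, _, _) := X in
    finite_set [set n : int | x n != 0]].

Definition locally_nilpotent (X : affine_hat) : Prop :=
  forall Y, exists k, iter k (affine_lie X) Y = 0.

Definition nilpotent (X : affine_hat) : Prop :=
  exists k, forall Y, iter k (affine_lie X) Y = 0.

End Affine.

Arguments affine {F} L _.

(* Main.v *)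
Require Import Defs.
From mathcomp Require Import all_boot all_algebra complex.
From mathcomp Require Import boolp classical_sets reals.
From mathcomp Require Import order sesquilinear fsbigop zify.

(** Write [X = x + l c + m d].  On the loop part [K (x) L] of the algebra, where
    [K] is the field of Laurent series, [ad X] acts through the operator
    [D y = [x, y] + m t y'] ([loop_ad]); everything is decided by [D].

    Local nilpotency forces [m = 0].  A locally nilpotent operator on a nonzero
    space kills some [v != 0], and since [D] differs from a [K]-linear map by a
    derivation, [D (t v) = t (D v) + m (t v) = m (t v)].  So [t v] is an
    eigenvector of [D] with eigenvalue [m], and [m != 0] contradicts local
    nilpotency ([loop_ad_locally_nilpotent_scalar0]).

    When [m = 0], [D] is [K]-linear ([laurent_extZr]) on a [K]-space spanned by
    the finitely many constant series given by a basis of [L]; a power of [D]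
    that kills all of them kills everything ([laurent_ext_nilpotent]).  In
    passing from [D] to [ad X], the components along [d] and [c] cost one more
    step each ([loop_ad_nilpotent]). *)

Local Open Scope classical_set_scope.
Local Open Scope ring_scope.
Local Open Scope complex_scope.

Set Implicit Arguments.
Unset Strict Implicit.
Unset Printing Implicit Defensive.

Import Order.TTheory GRing.Theory Num.Theory.

(** * Iterates of linear operators *)

(** The last nonzero iterate of [y] lies in the kernel. *)
Lemma iter_eq0_ker (V : nmodType) (f : V -> V) (y : V) (k : nat) :
  y <> 0 -> iter k f y = 0 -> exists2 v, v <> 0 & f v = 0.
Proof.
move=> y0; elim: k => [//|k IH] /= fk.
by have [/IH //|ne] := pselect (iter k f y = 0); exists (iter k f y).
Qed.

Lemma iter_linear_sum (F : fieldType) (V : lmodType F) (f : {linear V -> V})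
    (I : finType) (w : I -> V) (k : nat) :
  iter k f (\sum_i w i) = \sum_i iter k f (w i).
Proof. by elim: k => [//|k IH]; rewrite iterS IH linear_sum. Qed.

Lemma iter_eq0_leq (F : fieldType) (V : lmodType F) (f : {linear V -> V})
    (y : V) (j k : nat) :
  (j <= k)%N -> iter j f y = 0 -> iter k f y = 0.
Proof.
move=> /subnK <- fj; rewrite iterD fj.
by elim: (k - j)%N => [//|i IH]; rewrite iterS IH linear0.
Qed.

(** * Linearity over the field of Laurent series *)

Section LaurentLinear.
Variable F : fieldType.
Implicit Types U V W : lmodType F.

Definition laurent_scale V (f : laurent F^o) (v : laurent V) : laurent V :=
  laurent_ext (@scale_op F V) f v.

Fact laurent_const_subproof V (v : V) :
  (fun n : int => if n == 0 then v else 0) \in @bounded_below F V.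
Proof. by apply/asboolP; exists 0 => n; case: ltgtP. Qed.
Definition laurent_const V (v : V) : laurent V :=
  Laurent (laurent_const_subproof v).

(** Shows that the constant series span the Laurent series over the field of
    scalar series, together with [laurent_coord_tensor]. *)
Lemma laurent_tensor_scale V (f : laurent F^o) (v : V) :
  laurent_tensor f v = laurent_scale f (laurent_const v).
Proof.
apply: laurentP => n /=.
rewrite -(@fsbig_widen _ _ _ _ [set n]) //.
  by rewrite fsbig_set1 subrr eqxx.
move=> i [_ /eqP ni] /=; rewrite /scale_op ifF ?scaler0 //.
by apply/eqP => /subr0_eq ni'; rewrite ni' eqxx in ni.
Qed.

(** Both sides are the double sum of [f_j b(u_i, v_(n-i-j))] over [i, j]; the
    lower bounds of the supports make it finite, so the sums can be exchanged. *)
Lemma laurent_extZr U V W (b : {bilinear U -> V -> W}) (u : laurent U)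
    (f : laurent F^o) (v : laurent V) :
  laurent_ext b u (laurent_scale f v) = laurent_scale f (laurent_ext b u v).
Proof.
have [p up] := laurent_boundP u; have [q fq] := laurent_boundP f.
have [r vr] := laurent_boundP v.
have ext_bound U' V' W' (b' : {bilinear U' -> V' -> W'}) (u' : laurent U')
    (v' : laurent V') (p' q' : int) :
    (forall i, i < p' -> u' i = 0) -> (forall i, i < q' -> v' i = 0) ->
    forall i, i < p' + q' -> laurent_ext b' u' v' i = 0.
  move=> u'p v'q i ipq.
  by rewrite (@laurent_extE _ _ _ _ _ _ _ p' q' i 0) ?big_ord0 //; lia.
apply: laurentP => n; pose N := (absz (n - p - q - r)%R).+1.
(* [N] is large enough for every convolution below to be a sum over [k < N]. *)
rewrite (@laurent_extE _ _ _ _ b u _ p (q + r) n N) //; first last.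
- rewrite /N; lia.
- exact: ext_bound.
rewrite [RHS](@laurent_extE _ _ _ _ _ f _ q (p + r) n N) //; first last.
- rewrite /N; lia.
- exact: ext_bound.
transitivity (\sum_(k < N) \sum_(l < N)
    (f (q + l%:Z) : F) *: b (u (p + k%:Z)) (v (n - (p + k%:Z) - (q + l%:Z)))).
  apply: eq_bigr => k _.
  rewrite (@laurent_extE _ _ _ _ _ f v q r _ N) //; last by rewrite /N; lia.
  by rewrite linear_sumr; apply: eq_bigr => l _; rewrite linearZr.
rewrite exchange_big; apply: eq_bigr => l _.
rewrite (@laurent_extE _ _ _ _ _ u v p r _ N) //; last by rewrite /N; lia.
rewrite [RHS]linear_sumr; apply: eq_bigr => k _.
rewrite -[RHS]/((f (q + l%:Z) : F) *: _).
by congr (_ *: b _ (v _)); lia.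
Qed.

(** The case [f = t] of [laurent_extZr], in terms of [laurent_tmul].  The index
    set of the convolution is all of [int], so no bounds are involved. *)
Lemma laurent_ext_tmulr U V W (b : {bilinear U -> V -> W}) (u : laurent U)
    (v : laurent V) :
  laurent_ext b u (laurent_tmul v) = laurent_tmul (laurent_ext b u v).
Proof.
by apply: laurentP => n /=; apply: eq_fsbigr => i _; rewrite addrAC.
Qed.

Lemma laurent_eulerE V (v : laurent V) (n : int) :
  laurent_tmul (laurent_deriv v) n = v n *~ n.
Proof. by rewrite /= subrK. Qed.

(** The Leibniz rule for the Euler operator [t d/dt] on [t v]. *)
Lemma laurent_euler_tmul V (v : laurent V) :
  laurent_tmul (laurent_deriv (laurent_tmul v))
    = laurent_tmul (laurent_tmul (laurent_deriv v)) + laurent_tmul v.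
Proof.
apply: laurentP => n; rewrite laurent_coefD laurent_eulerE.
rewrite [X in X + _]laurent_eulerE /=.
by rewrite mulrzBr subrK.
Qed.

Lemma laurent_eulerZ V (a : F) (v : laurent V) :
  laurent_tmul (laurent_deriv (a *: v)) = a *: laurent_tmul (laurent_deriv v).
Proof.
by apply: laurentP => n; rewrite laurent_coefZ !laurent_eulerE scalerMzr.
Qed.

Lemma laurent_tmul0 V : laurent_tmul (0 : laurent V) = 0.
Proof. exact: laurentP. Qed.

Lemma laurent_tmul_eq0 V (v : laurent V) : laurent_tmul v = 0 -> v = 0.
Proof.
move=> tv; apply: laurentP => n.
by rewrite -[n](addrK 1) -[LHS]/(laurent_tmul v (n + 1)) tv.
Qed.

Lemma laurent_const_eq0 V (v : V) : laurent_const v = 0 -> v = 0.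
Proof. by move=> /(congr1 (fun u : laurent V => u 0)). Qed.

End LaurentLinear.

(** The operator is linear over scalar series, so the largest of the exponents
    needed by the finitely many constant basis series works everywhere. *)
Lemma laurent_ext_nilpotent (F : fieldType) (U : lmodType F) (V : vectType F)
    (b : {bilinear U -> V -> V}) (x : laurent U) :
  (forall y, exists k, iter k (laurent_ext b x) y = 0) ->
  exists k, forall y, iter k (laurent_ext b x) y = 0.
Proof.
pose D : {linear laurent V -> laurent V} :=
  (laurent_ext b : {bilinear laurent U -> laurent V -> laurent V}) x.
rewrite -[laurent_ext b x]/(D : _ -> _) => loc.
have [k kP] := choice (fun i : 'I_(\dim {:V}) =>
  loc (laurent_const (vbasis {:V})`_i)).
exists (\max_i k i)%N => y; rewrite [y]laurent_coord_tensor.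
have iterZ j f w : iter j D (laurent_scale f w)
    = laurent_scale f (iter j D w).
  by elim: j => [//|j IH]; rewrite !iterS IH; exact: laurent_extZr.
rewrite iter_linear_sum big1 // => i _.
rewrite laurent_tensor_scale iterZ (iter_eq0_leq _ (kP i)) ?leq_bigmax //.
exact: linear0r.
Qed.

(** * The adjoint action on the loop part *)

Section LoopAd.
Variables (F : fieldType) (L : lieAlgType F).
Implicit Types (x y : laurent L) (l m r : F^o).

Definition loop_ad x m y : laurent L :=
  laurent_ext (@lie F L) x y + (m : F) *: laurent_tmul (laurent_deriv y).

Lemma loop_adZ x m (a : F) y : loop_ad x m (a *: y) = a *: loop_ad x m y.
Proof.
rewrite /loop_ad laurent_eulerZ linearZr /= scalerDr.
by rewrite scalerA mulrC -scalerA.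
Qed.

(** This is where the [d] component shows: multiplication by [t] raises
    eigenvalues by [m]. *)
Lemma loop_ad_tmul x m y :
  loop_ad x m (laurent_tmul y)
    = laurent_tmul (loop_ad x m y) + (m : F) *: laurent_tmul y.
Proof.
rewrite /loop_ad laurent_ext_tmulr laurent_euler_tmul scalerDr addrA.
by congr (_ + _); apply: laurentP.
Qed.

Lemma loop_ad0 x y : loop_ad x 0 y = laurent_ext (@lie F L) x y.
Proof. by rewrite /loop_ad scale0r addr0. Qed.

(** The [c] component never feeds back into the loop component, and without a
    [d] component the bracket acts on the latter as [loop_ad]. *)
Lemma iter_affine_lie_loop x l m y r (k : nat) :
  exists s, iter k (affine_lie (x, l, m)) (y, r, 0)
    = (iter k (loop_ad x m) y, s, 0).
Proof.
elim: k => [|k [s IH]]; first by exists r.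
rewrite !iterS IH /affine_lie scale0r subr0.
by eexists.
Qed.

Lemma locally_nilpotent_loop_ad x l m :
  locally_nilpotent (x, l, m) ->
  forall y, exists k, iter k (loop_ad x m) y = 0.
Proof.
move=> loc y; have [k kP] := loc (y, 0, 0); exists k.
by have [s E] := iter_affine_lie_loop x l m y 0 k; move: kP; rewrite E => -[].
Qed.

(** For a nonzero [v] in the kernel, [t v] is an eigenvector with
    eigenvalue [m], which local nilpotency forces to vanish. *)
Lemma loop_ad_locally_nilpotent_scalar0 x m (e : L) :
  e != 0 -> (forall y, exists k, iter k (loop_ad x m) y = 0) -> m = 0.
Proof.
move=> e0 loc; have [k kP] := loc (laurent_const e).
have [|v v0 Dv] := iter_eq0_ker _ kP.
  by move/laurent_const_eq0/eqP; apply/negP.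
have eigen j : iter j (loop_ad x m) (laurent_tmul v)
    = (m : F) ^+ j *: laurent_tmul v.
  elim: j => [|j IH]; first by rewrite expr0 scale1r.
  rewrite iterS IH loop_adZ loop_ad_tmul Dv laurent_tmul0 add0r.
  by rewrite scalerA exprSr.
have [j] := loc (laurent_tmul v).
rewrite eigen => /eqP; rewrite scaler_eq0 expf_eq0.
case/orP => [/andP[_ /eqP //]|/eqP/laurent_tmul_eq0 //].
Qed.

(** The first bracket removes the [d] component of the argument, the next [k]
    remove the loop component, and the last one the [c] component, since [c] is
    central. *)
Lemma loop_ad_nilpotent x l :
  (exists k, forall y, iter k (loop_ad x 0) y = 0) -> nilpotent (x, l, 0).
Proof.
move=> [k kP]; exists k.+2 => -[[y r] m'].
rewrite iterSr iterS.
set Z := (X in iter k _ X); have [z [s ->]] : exists z s, Z = (z, s, 0).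
  by do 2!eexists.
have [s' ->] := iter_affine_lie_loop x l 0 z s k.
rewrite kP /affine_lie !scale0r subr0 addr0 !linear0r.
by [].
Qed.

End LoopAd.

(** * Locally nilpotent elements are nilpotent *)

Theorem theorem3p4 (R : realType) (L : lieAlgType R[i]) (L_simple : lie_simple L)
    (X : affine_hat L) (X_affine : affine L X) :
  locally_nilpotent X -> nilpotent X.
Proof.
have [[e [e' ee']] _] := L_simple.
have e0 : e != 0 by apply: contra_neq ee' => ->; exact: linear0l.
case: X {X_affine} => [[x l] m] /locally_nilpotent_loop_ad loc.
have m0 := loop_ad_locally_nilpotent_scalar0 e0 loc.
rewrite {}m0 in loc *; apply: loop_ad_nilpotent.
have D0 : loop_ad x 0 = laurent_ext (@lie _ L) x.
  by apply/funext => y; exact: loop_ad0.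
by rewrite D0 in loc *; exact: laurent_ext_nilpotent.
Qed.
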